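(* Let $\mathrm{S}=(P,T,F,M_0)$ be a place/transition net. If $\mathrm{S}$ is e/l-persistent, then it is e/l-$\mathrm{k}$-persistent for some $\mathrm{k}\in\mathbb{N}$, and such a $\mathrm{k}$ can be effectively computed (there is an algorithm that, given an e/l-persistent p/t-net, outputs a number $\mathrm{k}$ for which the net is e/l-$\mathrm{k}$-persistent).
   Context: A place/transition net (p/t-net) is $\mathrm{S}=(P,T,F,M_0)$ where $P$ (places) and $T$ (transitions) are finite disjoint sets, $F\subseteq P\times T\cup T\times P$ is the flow relation, and $M_0\in\mathbb{N}^P$ is the initial marking. Markings are vectors in $\mathbb{N}^P$, ordered and added componentwise. For $a\in T$, ${}^\bullet a\in\mathbb{N}^P$ is the vector with $1$ at places $p$ with $(p,a)\in F$ and $0$ elsewhere; $a^\bullet$ is the vector with $1$ at places $p$ with $(a,p)\in F$ and $0$ elsewhere. A transition $a$ is enabled in $M$ (written $Ma$) iff ${}^\bullet a\le M$; then firing $a$ yields $M'=(M-{}^\bullet a)+a^\bullet$ (written $MaM'$). This is extended to strings $w\in T^*$: $M\varepsilon M$, and $MvaM''$ iff $MvM'$ and $M'aM''$ for some $M'$; $Mw$ means $MwM'$ for some $M'$. The set $[M_0\rangle$ of reachable markings consists of all $M'$ with $M_0wM'$ for some $w\in T^*$. The net is e/l-persistent iff for all $M\in[M_0\rangle$ and all $a,b\in T$ with $a\ne b$: $Ma\wedge Mb\Rightarrow \exists v\in T^*\ Mavb$. For $\mathrm{k}\in\mathbb{N}$, a step $Ma$ is e/l-$\mathrm{k}$-persistent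 iff for every $b\in T$, $b\neq a$, $Mb$ implies that there exists $w\in T^*$ with $|w|\le\mathrm{k}$ and $Mawb$. A marking $M$ is e/l-$\mathrm{k}$-persistent iff for every $a\in T$ enabled in $M$ the step $Ma$ is e/l-$\mathrm{k}$-persistent; the net is e/l-$\mathrm{k}$-persistent iff every marking in $[M_0\rangle$ is e/l-$\mathrm{k}$-persistent. *)

(* Defs.v *)
From mathcomp Require Import all_boot.

Set Implicit Arguments.
Unset Strict Implicit.
Unset Printing Implicit Defensive.

(** * Place/transition nets *)

(* Places and transitions live in distinct types, hence are disjoint. *)
Record ptnet := PTNet {
  place : finType;
  trans : finType;
  flow : {set (place * trans) + (trans * place)};
  init : {ffun place -> nat} }.

Section Nets.

Variable S : ptnet.

Definition marking := {ffun place S -> nat}.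

Definition marking_le (M M' : marking) : bool := [forall p, M p <= M' p].

Definition preset (a : trans S) : marking :=
  [ffun p => (inl (p, a) \in flow S : nat)].

Definition postset (a : trans S) : marking :=
  [ffun p => (inr (a, p) \in flow S : nat)].

Definition enabled (M : marking) (a : trans S) : bool :=
  marking_le (preset a) M.

Definition fire (M : marking) (a : trans S) (M' : marking) : Prop :=
  enabled M a /\ M' = [ffun p => M p - preset a p + postset a p].

Inductive run (M : marking) : seq (trans S) -> marking -> Prop :=
| run_nil : run M [::] M
| run_rcons v a M' M'' : run M v M' -> fire M' a M'' -> run M (rcons v a) M''.

Definition fireable (M : marking) (w : seq (trans S)) : Prop :=
  exists M', run M w M'.

Definition reachable (M : marking) : Prop := exists w, run (init S) w M.

Definition el_persistent : Prop :=
  forall (M : marking) (a b : trans S),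
    reachable M -> a <> b -> enabled M a -> enabled M b ->
    exists v : seq (trans S), fireable M (a :: rcons v b).

Definition el_k_persistent_step (k : nat) (M : marking) (a : trans S) : Prop :=
  forall b : trans S, b <> a -> enabled M b ->
    exists w : seq (trans S), size w <= k /\ fireable M (a :: rcons w b).

Definition el_k_persistent_marking (k : nat) (M : marking) : Prop :=
  forall a : trans S, enabled M a -> el_k_persistent_step k M a.

Definition el_k_persistent (k : nat) : Prop :=
  forall M : marking, reachable M -> el_k_persistent_marking k M.

(* The finite presentation of a net handed to an algorithm: the numbers of
   places and transitions, the two incidence tables (row by row, as bits) and
   the initial marking, all listed along the enumerations of the places and of
   the transitions.  The first two entries fix the lengths of the other blocks,
   so the list determines the net up to renaming; [CodeSeq.code] is an effective
   bijection from lists of naturals to naturals. *)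
Definition net_data : seq nat :=
  [:: #|place S|; #|trans S|]
  ++ [seq (inl (p, a) \in flow S : nat)
       | p <- enum (place S), a <- enum (trans S)]
  ++ [seq (inr (a, p) \in flow S : nat)
       | a <- enum (trans S), p <- enum (place S)]
  ++ [seq init S p | p <- enum (place S)].

Definition net_code : nat := CodeSeq.code net_data.

End Nets.

(** * Partial recursive functions *)

(* An algorithm is a syntactic object (a definition of a partial recursive
   function): the mere existence of a function [ptnet -> nat] would follow from
   the axiom of choice and carry no computational content. *)
Inductive recfun : nat -> Type :=
| Zero n : recfun n
| Succ : recfun 1
| Proj n (i : 'I_n) : recfun n
| Comp m n (f : recfun m) (g : 'I_m -> recfun n) : recfun n
| Prec n (f : recfun n) (g : recfun n.+2) : recfun n.+1
| Mu n (f : recfun n.+1) : recfun n.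

(* [eval f v y]: the program [f] halts on input [v] with output [y].
   [Prec] recurses on its first argument, [h] being the course of values;
   [Mu] demands convergence of its body at all arguments below the output. *)
Fixpoint eval n (f : recfun n) : n.-tuple nat -> nat -> Prop :=
  match f in recfun n return n.-tuple nat -> nat -> Prop with
  | Zero _ => fun _ y => y = 0
  | Succ => fun v y => y = (thead v).+1
  | Proj _ i => fun v y => y = tnth v i
  | Comp m _ f g => fun v y =>
      exists u : m.-tuple nat, (forall i, eval (g i) v (tnth u i)) /\ eval f u y
  | Prec _ f g => fun v y =>
      exists h : nat -> nat,
        [/\ eval f [tuple of behead v] (h 0),
            forall i, i < thead v ->
              eval g [tuple of [:: i, h i & behead v]] (h i.+1)
          & y = h (thead v)]
  | Mu _ f => fun v y =>
      eval f [tuple of y :: v] 0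
      /\ forall i, i < y -> exists z, eval f [tuple of i :: v] z.+1
  end.

Lemma eval_functional n (f : recfun n) (v : n.-tuple nat) (y y' : nat) :
  eval f v y -> eval f v y' -> y = y'.
Proof.
elim: f v y y' => {n} [n|| n i | m n f IHf g IHg | n f IHf g IHg | n f IHf]
  v y y' /=.
- by move=> -> ->.
- by move=> -> ->.
- by move=> -> ->.
- move=> [u [gu fu]] [u' [gu' fu']].
  have E : u = u' by apply: eq_from_tnth => i; apply: IHg (gu i) (gu' i).
  by rewrite -E in fu'; apply: IHf fu fu'.
- move=> [h [h0 hS ->]] [h' [h0' hS' ->]].
  have H i : i <= thead v -> h i = h' i.
    elim: i => [_|i IHi lt_iv]; first exact: IHf h0 h0'.
    have E := IHi (ltnW lt_iv).
    by move: (hS' i lt_iv); rewrite -E => /(IHg _ _ _ (hS i lt_iv)).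
  exact: H.
- move=> [y0 yS] [y0' yS'].
  case: (ltngtP y y') => // lt.
    by have [z /(IHf _ _ _ y0)] := yS' _ lt.
  by have [z /(IHf _ _ _ y0')] := yS _ lt.
Qed.

(* Main.v *)
(* Whether [M w b] holds for some [w] is a coverability question, and Rackoff's
   argument bounds the length of a shortest such [w] by a number that depends
   only on the number of places, by induction on the set [Q] of places at which
   enabledness is checked.  If along [w] the places of [Q] stay below a bound
   [B], a long [w] visits some marking twice and can be cut.  Otherwise some
   place [q] of [Q] reaches [B] early; from there a short word that works for
   [Q] minus [q] also works for [Q], because one step consumes at most one token
   of [q].  Only an upper bound on the number of places is needed, and the code
   of a net is one, so the program never has to decode its input. *)
Require Import Defs.
From mathcomp Require Import all_boot.
From mathcomp Require Import zify.

Set Implicit Arguments.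
Unset Strict Implicit.
Unset Printing Implicit Defensive.

(** Here [n] bounds the number of places and [i] the number of checked ones. The power bounds the
    number of markings whose checked places hold at most [rackoff_bound n j] tokens; the other
    summand is the length allowed once a place has been dropped. *)
Fixpoint rackoff_bound (n i : nat) : nat :=
  if i is j.+1 then rackoff_bound n j + (rackoff_bound n j).+1 ^ n else 0.

(** * Firing checked on a subset of the places, and Rackoff's bound *)

Section RelativeFiring.

Variable S : ptnet.
Implicit Types (Q : {set place S}) (M : marking S) (a b : trans S).
Implicit Types (v w : seq (trans S)).

(* Truncated subtraction: meaningful only at places where [a] is enabled. *)
Definition next M a : marking S :=
  [ffun p => M p - preset a p + postset a p].

Definition enabled_on Q M a : bool := [forall p in Q, preset a p <= M p].

Fixpoint fireable_on Q M w : bool :=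
  if w is a :: w' then enabled_on Q M a && fireable_on Q (next M a) w'
  else true.

Lemma fireable_on_cat Q M v w :
  fireable_on Q M (v ++ w) =
  fireable_on Q M v && fireable_on Q (foldl next M v) w.
Proof. by elim: v M => //= a v IHv M; rewrite IHv andbA. Qed.

(** [next] acts on each place separately, so values outside [Q] never enter the check. *)
Lemma eq_fireable_on Q M M' w :
  {in Q, M =1 M'} -> fireable_on Q M w = fireable_on Q M' w.
Proof.
elim: w M M' => //= a w IHw M M' eqM; congr (_ && _).
  by apply: eq_forallb_in => p Qp; rewrite eqM.
by apply: IHw => p Qp; rewrite !ffunE eqM.
Qed.

Lemma fireable_onS Q Q' M w :
  Q \subset Q' -> fireable_on Q' M w -> fireable_on Q M w.
Proof.
move=> sQ; elim: w M => //= a w IHw M /andP[/forall_inP en /IHw ->].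
by rewrite andbT; apply/forall_inP => p /(subsetP sQ)/en.
Qed.

Lemma fireable_onD1 Q q M w :
  size w <= M q -> fireable_on (Q :\ q) M w -> fireable_on Q M w.
Proof.
elim: w M => //= a w IHw M szw /andP[/forall_inP en fw].
have pre1 p : preset a p <= 1 by rewrite ffunE leq_b1.
apply/andP; split.
  apply/forall_inP => p Qp; case: (eqVneq p q) => [->|neq].
    exact: leq_trans (pre1 q) (leq_trans _ szw).
  by apply: en; rewrite !inE neq.
by apply: IHw fw; rewrite ffunE; have := pre1 q; lia.
Qed.

Lemma pigeonhole_markings Q B n (m : 'I_n -> marking S) :
  B.+1 ^ #|place S| < n -> (forall i q, q \in Q -> m i q <= B) ->
  exists i j : 'I_n, i < j /\ {in Q, m i =1 m j}.
Proof.
move=> ltn mB.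
(* Places outside [Q] are sent to 0 to make the codomain finite; on [Q] the bound [B] makes [inord]
   exact. *)
pose f i : {ffun place S -> 'I_B.+1} :=
  [ffun p => if p \in Q then inord (m i p) else ord0].
have /injectiveP/injectivePn[i [j neq eqf]] : ~ injective f.
  move/leq_card; rewrite card_ffun !card_ord => /(leq_trans ltn).
  by rewrite ltnn.
have eqm : {in Q, m i =1 m j}.
  move=> p Qp; move/ffunP/(_ p)/(congr1 val): eqf.
  by rewrite !ffunE Qp /= !inordK ?ltnS ?mB.
case: (ltngtP i j) => [lt|lt|/val_inj eq]; last by rewrite eq eqxx in neq.
  by exists i, j.
by exists j, i; split => // p Qp; rewrite eqm.
Qed.

Lemma rackoff n i Q M w b :
  #|place S| <= n -> #|Q| <= i -> fireable_on Q M (rcons w b) ->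
  exists2 w', size w' <= rackoff_bound n i & fireable_on Q M (rcons w' b).
Proof.
move=> le_n; elim: i Q M w => [|i IHi] Q M w cardQ.
  move: cardQ; rewrite leqn0 cards_eq0 => /eqP -> _.
  by exists [::] => //=; rewrite andbT; apply/forall_inP => p; rewrite inE.
set L := rackoff_bound n i in IHi; rewrite /= -/L; set K := L.+1 ^ n.
have [m] := ubnP (size w); elim: m w => // m IHm w szw okw.
have [short|long] := leqP (size w) (L + K); first by exists w.
(* These are [K.+1] markings, one more than the pigeonhole needs to exceed. *)
pose mk (j : 'I_K.+1) := foldl next M (take j w).
have okj j : fireable_on Q M (take j w) &&
             fireable_on Q (foldl next M (take j w)) (rcons (drop j w) b).
  by rewrite -fireable_on_cat -rcons_cat cat_take_drop.
have [/existsP[j /exists_inP[q Qq big]]|] :=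
    boolP [exists j, exists q in Q, L < mk j q].
  have /andP[ok1 ok2] := okj j.
  have [||w' szw' okw'] := IHi (Q :\ q) (mk j) (drop j w).
  - by move: cardQ; rewrite (cardsD1 q) Qq.
  - exact: fireable_onS (subsetDl _ _) ok2.
  exists (take j w ++ w').
    have := size_take_min j w; have := ltn_ord j; rewrite size_cat; lia.
  (* The strict inequality [L < mk j q] leaves one token for the final [b]. *)
  rewrite rcons_cat fireable_on_cat ok1 /=; apply: fireable_onD1 okw'.
  by rewrite size_rcons; apply: leq_trans big.
move=> /existsPn small.
have [||j1 [j2 [lt_j eqm]]] := @pigeonhole_markings Q L K.+1 mk.
- by rewrite ltnS leq_pexp2l.
- move=> j q Qq; rewrite leqNgt; apply/negP => big.
  by have /exists_inP[] := small j; exists q.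
have /andP[ok1 _] := okj j1; have /andP[_ ok2] := okj j2.
(* The segment between two markings that agree on [Q] is cut out; since [j2 <= K < size w], the word
   gets strictly shorter. *)
apply: (IHm (take j1 w ++ drop j2 w)).
  have := size_take_min j1 w; have := ltn_ord j2.
  by rewrite size_cat size_drop; lia.
by rewrite rcons_cat fireable_on_cat ok1 /= (eq_fireable_on _ eqm).
Qed.

Lemma enabled_onT M a : enabled_on setT M a = enabled M a.
Proof. by apply: eq_forallb => p; rewrite inE. Qed.

(** [run] extends words at the right and [fireable_on] reads them from the left; both end in the
    marking [foldl next M w]. *)
Lemma fireableP M w : fireable M w <-> fireable_on setT M w.
Proof.
split=> [[M' r]|].
  suff [] : fireable_on setT M w /\ M' = foldl next M w by [].
  elim: r => // v a M1 M2 _ [okv ->] [en ->].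
  rewrite -cats1 fireable_on_cat okv foldl_cat /= enabled_onT en.
  by split.
suff H : fireable_on setT M w -> run M w (foldl next M w).
  by move/H; exists (foldl next M w).
elim/last_ind: w => [|v a IHv]; first by constructor.
rewrite -cats1 fireable_on_cat foldl_cat /= enabled_onT andbT cats1.
by case/andP=> /IHv r en; apply: run_rcons r _; split.
Qed.

Lemma el_persistent_rackoff n :
  #|place S| <= n -> el_persistent S -> el_k_persistent S (rackoff_bound n n).
Proof.
move=> le_n pers M reM a enMa b /eqP neq enMb.
have [|v /fireableP] := pers M a b reM _ enMa enMb.
  by move=> eq; rewrite eq eqxx in neq.
move=> /= /andP[en okv].
(* The word [v] given by persistence is shortened from the marking reached by [a]. *)
have [|w szw okw] := @rackoff n n setT _ v b le_n _ okv.
  by rewrite cardsT.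
by exists w; split=> //; apply/fireableP; rewrite /= en.
Qed.

(** The code of a list with head [x] is [2 ^ x] times an odd number, and the head here is the number
    of places. *)
Lemma card_place_le_code : #|place S| <= net_code S.
Proof.
apply: leq_trans (ltnW (ltn_expl _ (ltnSn 1))) _.
by rewrite /net_code /net_data /= leq_pmulr.
Qed.

End RelativeFiring.

(** * Recursive programs computing the bound *)

Definition computes2 (f : recfun 2) (F : nat -> nat -> nat) : Prop :=
  forall x y, eval f [tuple x; y] (F x y).

Definition comp2 n (f : recfun 2) (g1 g2 : recfun n) : recfun n :=
  Comp f (tnth [tuple g1; g2]).

Lemma eval_comp2 n f F (g1 g2 : recfun n) v y1 y2 :
  computes2 f F -> eval g1 v y1 -> eval g2 v y2 ->
  eval (comp2 f g1 g2) v (F y1 y2).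
Proof.
move=> fF e1 e2; exists [tuple y1; y2]; split; last exact: fF.
by case=> [[|[|//]] lt].
Qed.

Lemma computes2_prec (f : recfun 1) (g : recfun 3) (F : nat -> nat -> nat) :
  (forall y, eval f [tuple y] (F 0 y)) ->
  (forall x y, eval g [tuple x; F x y; y] (F x.+1 y)) ->
  computes2 (Prec f g) F.
Proof.
move=> fF gF x y; exists (F^~ y); split=> // [|i _].
- by have -> : [tuple of behead [tuple x; y]] = [tuple y]; [apply: val_inj|].
- have -> : [tuple of [:: i, F i y & behead [tuple x; y]]]
            = [tuple i; F i y; y] by apply: val_inj.
  exact: gF.
Qed.

Definition succ_of n (g : recfun n) : recfun n := Comp Succ (fun _ => g).

Lemma eval_succ_of n (g : recfun n) v y : eval g v y -> eval (succ_of g) v y.+1.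
Proof. by move=> e; exists [tuple y]; split=> // i; rewrite ord1. Qed.

(** In the step of a binary recursion, arguments 0, 1 and 2 are the counter, the previous value and
    the parameter. *)
Definition arg3 (i : nat) : recfun 3 := Proj (inord i).

Lemma eval_arg3 i (v : 3.-tuple nat) : i < 3 -> eval (arg3 i) v (nth 0 v i).
Proof. by move=> lt; rewrite /= (tnth_nth 0) inordK. Qed.

Definition rec_add : recfun 2 := Prec (Proj ord0) (succ_of (arg3 1)).

Lemma rec_addP : computes2 rec_add addn.
Proof.
apply: computes2_prec => [y|x y]; first by [].
exact: eval_succ_of (eval_arg3 _ (isT : 1 < 3)).
Qed.

Definition rec_mul : recfun 2 :=
  Prec (Zero 1) (comp2 rec_add (arg3 2) (arg3 1)).

Lemma rec_mulP : computes2 rec_mul muln.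
Proof.
apply: computes2_prec => [y|x y]; first by [].
rewrite mulSn.
by apply: (eval_comp2 rec_addP); [exact: (@eval_arg3 2)|exact: (@eval_arg3 1)].
Qed.

(** [Prec] recurses on its first argument, so the exponent comes first. *)
Definition rec_exp : recfun 2 :=
  Prec (succ_of (Zero 1)) (comp2 rec_mul (arg3 2) (arg3 1)).

Lemma rec_expP : computes2 rec_exp (fun n x => x ^ n).
Proof.
apply: computes2_prec => [y|x y]; first exact: eval_succ_of.
rewrite expnS.
by apply: (eval_comp2 rec_mulP); [exact: (@eval_arg3 2)|exact: (@eval_arg3 1)].
Qed.

(** The recursion runs over [i] with [n] as parameter, which swaps the arguments of
    [rackoff_bound]. *)
Definition rec_rackoff : recfun 2 :=
  Prec (Zero 1)
    (comp2 rec_add (arg3 1) (comp2 rec_exp (arg3 2) (succ_of (arg3 1)))).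

Lemma rec_rackoffP : computes2 rec_rackoff (fun i n => rackoff_bound n i).
Proof.
apply: computes2_prec => [y|x y]; first by [].
apply: (eval_comp2 rec_addP); first exact: (@eval_arg3 1).
apply: (eval_comp2 rec_expP); first exact: (@eval_arg3 2).
by apply: eval_succ_of; exact: (@eval_arg3 1).
Qed.

Theorem theorem12 :
  (forall S : ptnet, el_persistent S -> exists k : nat, el_k_persistent S k)
  /\
  (exists f : recfun 1,
     forall S : ptnet, el_persistent S ->
       exists k : nat, eval f [tuple net_code S] k /\ el_k_persistent S k).
Proof.
split=> [S pers|].
  by exists (rackoff_bound #|place S| #|place S|); exact: el_persistent_rackoff.
(* The input code bounds the number of places, so it serves both as recursion depth and as
   parameter. *)
exists (comp2 rec_rackoff (Proj ord0) (Proj ord0)) => S pers.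
exists (rackoff_bound (net_code S) (net_code S)); split.
  exact: (eval_comp2 rec_rackoffP).
exact: el_persistent_rackoff (card_place_le_code S) pers.
Qed.
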